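(* Let $N$ and $r$ be positive integers and $i \in \{0, 1, \ldots, N-1\}$. Suppose that $K$ is a compact interval contained in $$\Lambda = \Big\{x \in \mathbb{R} : \lim_{n \to \infty} \operatorname{discr}\big(X_{nN+i}(x)\big) \text{ exists and is negative}\Big\}.$$ Assume that $$\lim_{n \to \infty} \frac{a_{(n+1)N+i-1}}{a_{nN+i-1}} = 1,$$ and $(X_{nN+i} : n \in \mathbb{N}) \in \mathcal{D}_r\big(K, \operatorname{GL}(2, \mathbb{R})\big)$. Suppose that $\mathcal{X}: K \rightarrow \operatorname{GL}(2, \mathbb{R})$ is the limit of $(X_{nN+i})$. Let $h(x) = \lim_{n \to \infty} \operatorname{discr}(X_{nN+i}(x))$ for $x\in K$, and let $\nu$ be a probability measure on $\mathbb{R}$ such that $(p_n : n\in\mathbb{N}_0)$ are orthonormal in $L^2(\mathbb{R},\nu)$ and which is absolutely continuous on $K$ with the density $\nu'(x)=\frac{\sqrt{-h(x)}}{2\pi g(x)}$, $x \in K$, where $g: K\to\mathbb{R}$ is the positive function satisfying $$\lim_{\substack{n \to \infty\\ n \equiv i \bmod N}} \sup_{x \in K} \Big| a_{n+N-1} \big|p_{n}(x) p_{n+N-1}(x) - p_{n-1}(x) p_{n+N}(x) \big| - g(x) \Big| = 0.$$ Then there are $M \geq 1$, a continuous real-valued function $\eta$ on $K$, and continuous functions $\theta_j: K \rightarrow (0, \pi)$ such that $$\lim_{n \to \infty} \sup_{x \in K} \bigg| \sqrt{a_{nN+i-1}}\, p_{nN+i}(x) - \sqrt{\frac{2 \big|[\mathcal{X}(x)]_{2,1}\big|}{\pi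 \nu'(x) \sqrt{-h(x)}}} \sin \Big( \sum_{j=M+1}^{n} \theta_j(x) + \eta(x) \Big) \bigg| = 0$$ and $$\lim_{j \to \infty} \sup_{x \in K} \bigg| \theta_j(x) - \arccos \Big( \tfrac{1}{2} \operatorname{tr} \mathcal{X}(x) \Big) \bigg| = 0.$$
   Context: $\mathbb{N}$ is the set of positive integers, $\mathbb{N}_0=\mathbb{N}\cup\{0\}$. $(a_n : n \in \mathbb{N}_0)$ is a sequence of positive numbers and $(b_n : n \in \mathbb{N}_0)$ a sequence of real numbers. For $n\ge 1$ and $x \in \mathbb{R}$, $$B_n(x) = \begin{pmatrix} 0 & 1 \\ -\frac{a_{n-1}}{a_n} & \frac{x-b_n}{a_n} \end{pmatrix}, \qquad X_n(x) = \prod_{j=n}^{n+N-1} B_j(x) = B_{n+N-1}(x) B_{n+N-2}(x)\cdots B_n(x).$$ The polynomials $(p_n)$ are defined by $p_0(x)=1$, $p_1(x)=\frac{x-b_0}{a_0}$ and $a_np_{n+1}(x)+b_np_n(x)+a_{n-1}p_{n-1}(x)=xp_n(x)$ for $n\ge1$. For a $2\times2$ matrix $X$, $\operatorname{discr} X = (\operatorname{tr} X)^2 - 4\det X$, and $[X]_{2,1}$ is the entry in the second row and first column. A function $g$ and a measure $\nu$ with the properties named in the claim exist under its hypotheses. For a compact set $K\subset\mathbb{R}$ and $r\in\mathbb{N}$, a uniformly bounded sequence of continuous mappings $A_n : K\to \operatorname{GL}(2,\mathbb{R})$, $n \geq 1$, belongs to $\mathcal{D}_r(K,\operatorname{GL}(2,\mathbb{R}))$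 if for each $j\in\{1,\ldots,r\}$, $$\sum_{n\ge1}\sup_{x\in K}\big\|\Delta^jA_n(x)\big\|^{r/j}<\infty,$$ where $\Delta^0A_n=A_n$ and $\Delta^jA_n=\Delta^{j-1}A_{n+1}-\Delta^{j-1}A_n$. *)

(* Defs.v *)
From HB Require Import structures.
From mathcomp Require Import all_boot all_order all_algebra.
From mathcomp Require Import all_classical all_reals all_analysis.

Set Implicit Arguments.
Unset Strict Implicit.
Unset Printing Implicit Defensive.

Import Order.TTheory GRing.Theory Num.Theory.
Import numFieldNormedType.Exports.

Local Open Scope classical_set_scope.
Local Open Scope ring_scope.

(** Jacobi parameters [a], [b] are sequences indexed from 0. *)

(* Meaningful for [0 < n] only: [n.-1] is truncated at [n = 0]. *)
Definition transfer_mx (R : realType) (a b : nat -> R) (n : nat) (x : R)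
    : 'M[R]_2 :=
  \matrix_(k, l) nth 0 (nth [::] [:: [:: 0; 1];
    [:: - (a n.-1 / a n); (x - b n) / a n]] k) l.

(* B_{n+N-1}(x) ... B_n(x): the factor with the largest index is leftmost. *)
Definition nstep_mx (R : realType) (a b : nat -> R) (N n : nat) (x : R)
    : 'M[R]_2 :=
  \prod_(j <- rev (iota n N)) transfer_mx a b j x.

Definition discr (R : realType) (A : 'M[R]_2) : R := (\tr A) ^+ 2 - 4 * \det A.

Fixpoint orthpoly (R : realType) (a b : nat -> R) (n : nat) : {poly R} :=
  match n with
  | 0 => 1
  | m.+1 => match m with
    | 0 => (a 0)^-1 *: ('X - (b 0)%:P)
    | k.+1 => (a m)^-1 *:
        (('X - (b m)%:P) * orthpoly a b m - a k *: orthpoly a b k)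
    end
  end.

Lemma orthpoly_rec (R : realType) (a b : nat -> R) (n : nat) (x : R) :
  (forall k, 0 < a k) -> (0 < n)%N ->
  a n * (orthpoly a b n.+1).[x] + b n * (orthpoly a b n).[x]
    + a n.-1 * (orthpoly a b n.-1).[x] = x * (orthpoly a b n).[x].
Proof.
case: n => // k apos _.
have ak : a k.+1 != 0 by rewrite gt_eqF.
rewrite -[X in a _ * X.[x]]/((a k.+1)^-1 *:
  (('X - (b k.+1)%:P) * orthpoly a b k.+1 - a k *: orthpoly a b k)).
rewrite hornerZ mulrA divff // mul1r !hornerE.
by rewrite mulrBl addrAC subrK subrK.
Qed.

(* Extended real valued, so that an unbounded function gets +oo; the value on
   an empty [K] is -oo. *)
Definition supnorm (R : realType) (V : normedModType R) (K : set R)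
    (f : R -> V) : \bar R :=
  ereal_sup [set (`|f x|)%:E | x in K].

Fixpoint fdiff (R : realType) (V : zmodType) (j : nat) (A : nat -> R -> V)
    : nat -> R -> V :=
  match j with
  | 0 => A
  | k.+1 => fun n x => fdiff k A n.+1 x - fdiff k A n x
  end.

(* The sequence is indexed from 1: [A 0] is irrelevant. The norm on 'M[R]_2 is
   the largest modulus of an entry; all norms on 'M[R]_2 being equivalent, the
   class does not depend on this choice. *)
Definition classD (R : realType) (r : nat) (K : set R)
    (A : nat -> R -> 'M[R]_2) : Prop :=
  [/\ forall n x, (0 < n)%N -> K x -> A n x \in unitmx,
      forall n, (0 < n)%N -> {within K, continuous (A n)},
      exists C : R, forall n x, (0 < n)%N -> K x -> `|A n x| <= C
    & forall j, (0 < j <= r)%N ->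
        (\sum_(1 <= n <oo) supnorm K (fdiff j A n) `^ (r%:R / j%:R) < +oo)%E].

Definition Lambda (R : realType) (a b : nat -> R) (N i : nat) : set R :=
  [set x | exists2 l : R,
     discr (nstep_mx a b N (n * N + i) x) @[n --> \oo] --> l & l < 0].

Definition orthonormal_in (R : realType) (nu : probability (measurableTypeR R) R)
    (p : nat -> {poly R}) : Prop :=
  forall m n,
    nu.-integrable setT (fun x : R => ((p m).[x] * (p n).[x])%:E) /\
    (\int[nu]_(x in [set: R]) ((p m).[x] * (p n).[x])%:E)%E = ((m == n)%:R)%:E.

Definition has_density_on (R : realType) (nu : probability (measurableTypeR R) R)
    (K : set R) (f : R -> R) : Prop :=
  measurable_fun K f /\
  forall A : set R, measurable A -> A `<=` K ->
    nu A = (\int[lebesgue_measure]_(x in A) (f x)%:E)%E.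

(* Main.v *)
Require Import Defs.
From HB Require Import structures.
From mathcomp Require Import all_boot all_order all_algebra.
From mathcomp Require Import all_classical all_reals all_analysis.
From mathcomp Require Import zify ring lra.

Set Implicit Arguments.
Unset Strict Implicit.
Unset Printing Implicit Defensive.

Import Order.TTheory GRing.Theory Num.Theory.
Import numFieldNormedType.Exports.

Local Open Scope classical_set_scope.
Local Open Scope ring_scope.

(** The vector [(p_{m-1}, p_m)] with [m = n N + i] is multiplied by the [N]-step
    transfer matrix [X_m(x)] when [n] increases by 1. These matrices converge to
    [X x], which has determinant 1 (the ratios of the [a]'s tend to 1) and negative
    discriminant, so it is conjugate to the rotation by
    [theta x = acos (\tr (X x) / 2)]. Put
    [s = sqrt (a_{m-1}) p_{m-1}] and [u = sqrt (a_{m-1}) p_m]. The sequence that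
    defines [g] is, up to a factor tending to 1, the absolute value of a quadratic
    form in [(s, u)] whose discriminant is that of [X_m(x)] ([wronskian_form]).
    The form is definite, so its convergence bounds [s] and [u]. In the coordinates
    [(y, u)] in which [X x] is a rotation, the limiting form is proportional to
    [y ^+ 2 + u ^+ 2]. Hence the length of [(y, u)] converges uniformly, and its
    limit is the amplitude of the theorem once [dnu] is expressed by [g] and [h]
    ([elliptic_recurrence]).

    It remains to follow the polar angle of [(y, u)]. Each step is the rotation by
    [theta x] up to a uniformly small error while the length stays away from 0, so
    the angle increases by [theta x] plus a small correction, the arcsine of a
    cross product. Taking these exact increments for the phase functions, and a
    continuous polar angle of one late vector for [eta] ([angle_lift]), makes the
    phase exact; only the length is replaced by its limit
    ([asymptotic_rotation]).

    Uniformity in [x] comes from the entries of [X_m(x)] being polynomials of degree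
    at most [N]: for these, pointwise convergence on a segment is uniform
    ([bounded_degree_unif0]), and it makes the entries of [X] continuous. Lower
    bounds such as [- discr (X x) >= m > 0] then follow by compactness. *)

(** * Uniformly negligible and uniformly bounded sequences of functions *)

(** Uniform convergence to 0 on [K] is kept in this elementary form, instead of
    through [supnorm], so that sums, products and comparisons of error terms can
    be handled without extended reals; [supnorm_cvg0P] translates. *)
Definition unif0 (R : realType) (K : set R) (f : nat -> R -> R) : Prop :=
  forall e, 0 < e -> \forall n \near \oo, forall x, K x -> `|f n x| <= e.

(** Only the tail of the sequence is bounded: this is all that products with
    [unif0] sequences need, and the first terms may be anything. *)
Definition unif_bounded (R : realType) (K : set R) (f : nat -> R -> R) : Prop :=
  exists B, \forall n \near \oo, forall x, K x -> `|f n x| <= B.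

Lemma unif0_le (R : realType) (K : set R) (f g : nat -> R -> R) :
  (\forall n \near \oo, forall x, K x -> `|f n x| <= `|g n x|) ->
  unif0 K g -> unif0 K f.
Proof.
move=> fg g0 e e0; near=> n => x Kx.
apply: (@le_trans _ _ `|g n x|); first by move: x Kx; near: n.
by move: x Kx; near: n; exact: g0.
Unshelve. all: by end_near. Qed.

Lemma unif0_eq (R : realType) (K : set R) (f g : nat -> R -> R) :
  (forall n x, K x -> f n x = g n x) -> unif0 K g -> unif0 K f.
Proof.
by move=> fg; apply: unif0_le; near=> n => x Kx; rewrite fg.
Unshelve. all: by end_near. Qed.

Lemma unif0D (R : realType) (K : set R) (f g : nat -> R -> R) :
  unif0 K f -> unif0 K g -> unif0 K (fun n x => f n x + g n x).
Proof.
move=> f0 g0 e e0; have e20 : 0 < e / 2 by lra.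
near=> n => x Kx; apply: (le_trans (ler_normD _ _)).
rewrite [e]splitr lerD //.
  by move: x Kx; near: n; exact: f0.
by move: x Kx; near: n; exact: g0.
Unshelve. all: by end_near. Qed.

Lemma unif0N (R : realType) (K : set R) (f : nat -> R -> R) :
  unif0 K f -> unif0 K (fun n x => - f n x).
Proof. by apply: unif0_le; near=> n => x _; rewrite normrN.
Unshelve. all: by end_near. Qed.

Lemma unif0B (R : realType) (K : set R) (f g : nat -> R -> R) :
  unif0 K f -> unif0 K g -> unif0 K (fun n x => f n x - g n x).
Proof. by move=> f0 g0; apply: unif0D => //; exact: unif0N. Qed.

Lemma unif0M (R : realType) (K : set R) (f g : nat -> R -> R) :
  unif0 K f -> unif_bounded K g -> unif0 K (fun n x => f n x * g n x).
Proof.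
move=> f0 [B gB] e e0; have B1 : 0 < `|B| + 1 by rewrite ltr_wpDl.
near=> n => x Kx; rewrite normrM.
have fe : `|f n x| <= e / (`|B| + 1).
  by move: x Kx; near: n; apply: f0; rewrite divr_gt0.
have gb : `|g n x| <= `|B| + 1.
  apply: (@le_trans _ _ B); first by move: x Kx {fe}; near: n.
  by rewrite (le_trans (ler_norm _)) // lerDl.
by rewrite (le_trans (ler_pM _ _ fe gb)) // divfK // gt_eqF.
Unshelve. all: by end_near. Qed.

Lemma unif0Ml (R : realType) (K : set R) (f g : nat -> R -> R) :
  unif_bounded K f -> unif0 K g -> unif0 K (fun n x => f n x * g n x).
Proof.
by move=> fB g0; apply: unif0_eq (unif0M g0 fB) => n x _; rewrite mulrC.
Qed.

Lemma unif0_sum (R : realType) (K : set R) m (f : 'I_m -> nat -> R -> R) :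
  (forall i, unif0 K (f i)) -> unif0 K (fun n x => \sum_(i < m) f i n x).
Proof.
elim: m f => [|m IH] f f0.
  move=> e e0; near=> n => x _; by rewrite big_ord0 normr0 ltW.
apply: (@unif0_eq _ _ _ (fun n x => \sum_(i < m) f (widen_ord (leqnSn m) i) n x
  + f ord_max n x)).
  by move=> n x _; rewrite big_ord_recr.
by apply: unif0D => //; apply: IH.
Unshelve. all: by end_near. Qed.

Lemma unif0_bounded (R : realType) (K : set R) (f : nat -> R -> R) :
  unif0 K f -> unif_bounded K f.
Proof. by move=> f0; exists 1; exact: f0. Qed.

Lemma unif_boundedD (R : realType) (K : set R) (f g : nat -> R -> R) :
  unif_bounded K f -> unif_bounded K g ->
  unif_bounded K (fun n x => f n x + g n x).
Proof.
move=> [B fB] [C gC]; exists (B + C); near=> n => x Kx.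
rewrite (le_trans (ler_normD _ _)) // lerD //.
  by move: x Kx; near: n.
by move: x Kx; near: n.
Unshelve. all: by end_near. Qed.

Lemma unif_boundedN (R : realType) (K : set R) (f : nat -> R -> R) :
  unif_bounded K f -> unif_bounded K (fun n x => - f n x).
Proof.
move=> [B fB]; exists B; near=> n => x Kx; rewrite normrN.
by move: x Kx; near: n.
Unshelve. all: by end_near. Qed.

Lemma unif_boundedM (R : realType) (K : set R) (f g : nat -> R -> R) :
  unif_bounded K f -> unif_bounded K g ->
  unif_bounded K (fun n x => f n x * g n x).
Proof.
move=> [B fB] [C gC]; exists (B * C); near=> n => x Kx.
rewrite normrM ler_pM //.
  by move: x Kx; near: n.
by move: x Kx; near: n.
Unshelve. all: by end_near. Qed.

Lemma unif_bounded_lim (R : realType) (K : set R) (f : nat -> R -> R) (l : R -> R) :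
  unif0 K (fun n x => f n x - l x) -> unif_bounded K (fun _ => l) ->
  unif_bounded K f.
Proof.
move=> /unif0_bounded fl lB; have [B HB] := unif_boundedD fl lB.
exists B; near=> n => x Kx.
have -> : f n x = f n x - l x + l x by rewrite subrK.
by move: x Kx; near: n.
Unshelve. all: by end_near. Qed.

Lemma unif_bounded_cst (R : realType) (K : set R) (r : R) :
  unif_bounded K (fun _ _ => r).
Proof. by exists `|r|; exact: nearW. Qed.

Lemma unif0_limM (R : realType) (K : set R) (f f' : nat -> R -> R) (l l' : R -> R) :
  unif_bounded K (fun _ => l) -> unif_bounded K f' ->
  unif0 K (fun n x => f n x - l x) -> unif0 K (fun n x => f' n x - l' x) ->
  unif0 K (fun n x => f n x * f' n x - l x * l' x).
Proof.
move=> lB f'B fl f'l'.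
apply: (@unif0_eq _ _ _ (fun n x => (f n x - l x) * f' n x + l x * (f' n x - l' x))).
  by move=> n x _; ring.
by apply: unif0D; [exact: unif0M|exact: unif0Ml].
Qed.

Lemma cvg_unif0 (R : realType) (K : set R) (r : nat -> R) :
  r n @[n --> \oo] --> 0 -> unif0 K (fun n _ => r n).
Proof.
move=> /cvgr0Pnorm_le r0 e e0; near=> n => x _; near: n; exact: r0.
Unshelve. all: by end_near. Qed.

Lemma unif0_comp (R : realType) (K : set R) (phi : R -> R) (f : nat -> R -> R) :
  {for 0, continuous phi} -> phi 0 = 0 -> unif0 K f ->
  unif0 K (fun n x => phi (f n x)).
Proof.
move=> /cvgrPdist_le cphi phi0 f0 e e0.
have [r /= r0 hr] := cphi e e0.
have r20 : 0 < r / 2 by lra.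
near=> n => x Kx.
have fr : `|f n x| <= r / 2 by move: x Kx; near: n; exact: f0.
have := hr (f n x); rewrite /ball_ /= phi0 !sub0r !normrN; apply.
by apply: le_lt_trans fr _; lra.
Unshelve. all: by end_near. Qed.

(** The set [K] has to be nonempty: the supremum over the empty set is -oo,
    which does not tend to 0. *)
Lemma supnorm_cvg0P (R : realType) (K : set R) (F : set_system nat)
    (FF : Filter F) (f : nat -> R -> R) : K !=set0 ->
  (supnorm K (f n) @[n --> F] --> 0%E) <->
  (forall e, 0 < e -> \forall n \near F, forall x, K x -> `|f n x| <= e).
Proof.
move=> [x0 Kx0].
have ge0 n : (0 <= supnorm K (f n))%E.
  apply: (@le_trans _ _ (`|f n x0|)%:E); first by rewrite lee_fin.
  by apply: ereal_sup_ubound; exists x0.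
split=> [/fine_cvgP[fin /cvgr0Pnorm_le cv] e e0|cv].
  near=> n => x Kx.
  have fn : supnorm K (f n) \is a fin_num by near: n.
  have : `|fine (supnorm K (f n))| <= e by near: n; exact: cv.
  rewrite ger0_norm ?fine_ge0 //; apply: le_trans.
  by rewrite -lee_fin fineK //; apply: ereal_sup_ubound; exists x.
have le e : 0 < e -> \forall n \near F, (supnorm K (f n) <= e%:E)%E.
  move=> e0; near=> n; apply: ge_ereal_sup => _ [x Kx <-]; rewrite lee_fin.
  by move: x Kx; near: n; exact: cv.
have fin : \forall n \near F, supnorm K (f n) \is a fin_num.
  near=> n; rewrite ge0_fin_numE //.
  by apply: (@le_lt_trans _ _ (1%:E)); [near: n; exact: le|exact: ltry].
apply/fine_cvgP; split => //; apply/cvgr0Pnorm_le => e e0.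
near=> n; rewrite ger0_norm ?fine_ge0 // -lee_fin fineK; first by near: n; exact: le.
by near: n.
Unshelve. all: by end_near. Qed.

Lemma unif0_supnorm (R : realType) (K : set R) (f : nat -> R -> R) : K !=set0 ->
  unif0 K f -> supnorm K (f n) @[n --> \oo] --> 0%E.
Proof. by move=> K0 f0; apply/supnorm_cvg0P. Qed.

(** * Continuity on a segment and lifting of angles *)

Lemma within_continuousP (R : realType) (K : set R) (f : R -> R) :
  {within K, continuous f} <->
  forall x e, K x -> 0 < e ->
    exists2 r, 0 < r & forall t, K t -> `|x - t| < r -> `|f x - f t| <= e.
Proof.
split=> [/subspace_continuousP cf x e Kx e0|cf].
  have /cvgrPdist_le/(_ _ e0) := cf x Kx.
  by rewrite near_withinE => -[r /= r0 hr]; exists r => // t Kt xt; exact: hr.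
apply/subspace_continuousP => x Kx; apply/cvgrPdist_le => e e0.
have [r r0 hr] := cf x e Kx e0.
by rewrite near_withinE; exists r => // t xt Kt; exact: hr.
Qed.

Lemma within_continuous_comp (R : realType) (K : set R) (f phi : R -> R) :
  {within K, continuous f} ->
  (forall x, K x -> {for f x, continuous phi}) ->
  {within K, continuous (fun x => phi (f x))}.
Proof.
move=> /subspace_continuousP cf cphi; apply/subspace_continuousP => x Kx.
exact: (cvg_comp _ _ (cf x Kx) (cphi x Kx)).
Qed.

Lemma within_continuous_add (R : realType) (K : set R) (f g : R -> R) :
  {within K, continuous f} -> {within K, continuous g} ->
  {within K, continuous (fun x => f x + g x)}.
Proof. by move=> cf cg x; apply: continuousD; [exact: cf|exact: cg]. Qed.

Lemma within_continuous_opp (R : realType) (K : set R) (f : R -> R) :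
  {within K, continuous f} -> {within K, continuous (fun x => - f x)}.
Proof. by move=> cf x; apply: continuousN; exact: cf. Qed.

Lemma within_continuous_mul (R : realType) (K : set R) (f g : R -> R) :
  {within K, continuous f} -> {within K, continuous g} ->
  {within K, continuous (fun x => f x * g x)}.
Proof. by move=> cf cg x; apply: continuousM; [exact: cf|exact: cg]. Qed.

Lemma within_continuous_cst (R : realType) (K : set R) (r : R) :
  {within K, continuous (fun _ => r)}.
Proof. by move=> x; exact: cvg_cst. Qed.

Lemma within_continuous_inv (R : realType) (K : set R) (f : R -> R) :
  {within K, continuous f} -> (forall x, K x -> f x != 0) ->
  {within K, continuous (fun x => (f x)^-1)}.
Proof.
move=> cf f0; apply: within_continuous_comp => // x Kx.
by apply: inv_continuous; exact: f0.
Qed.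

Lemma within_continuous_eq (R : realType) (K : set R) (f g : R -> R) :
  (forall x, K x -> f x = g x) -> {within K, continuous f} ->
  {within K, continuous g}.
Proof.
by move=> fg; apply: subspace_eq_continuous => x; rewrite inE => Kx; exact: fg.
Qed.

Lemma unif0_continuous (R : realType) (K : set R) (f : nat -> R -> R) (l : R -> R) :
  (\forall n \near \oo, {within K, continuous (f n)}) ->
  unif0 K (fun n x => f n x - l x) -> {within K, continuous l}.
Proof.
move=> cf fl; apply/within_continuousP => x e Kx e0.
have e30 : 0 < e / 3 by lra.
near \oo => n.
have d t : K t -> `|f n t - l t| <= e / 3.
  by move=> Kt; move: t Kt; near: n; exact: fl.
have /within_continuousP/(_ x _ Kx e30)[r r0 hr] :
  {within K, continuous (f n)} by near: n.
exists r => // t Kt xt.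
move: (d x Kx) (d t Kt) (hr t Kt xt).
rewrite !ler_norml => /andP[? ?] /andP[? ?] /andP[? ?].
by apply/andP; split; lra.
Unshelve. all: by end_near. Qed.

Lemma within_itv_bounded (R : realType) (c d : R) (f : R -> R) : c <= d ->
  {within `[c, d], continuous f} ->
  unif_bounded `[c, d]%classic (fun _ => f).
Proof.
move=> cd cf.
have [u _ hu] := EVT_max cd cf; have [v _ hv] := EVT_min cd cf.
exists (`|f u| + `|f v|); apply: nearW => _ x Kx.
have := hu x Kx; have := hv x Kx.
have := ler_norm (f u); have := ler_norm (- f v).
have := normr_ge0 (f u); have := normr_ge0 (f v); rewrite normrN.
by rewrite ler_norml => *; apply/andP; split; lra.
Qed.

Lemma within_itv_gt0 (R : realType) (c d : R) (f : R -> R) : c <= d ->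
  {within `[c, d], continuous f} ->
  (forall x, `[c, d]%classic x -> 0 < f x) ->
  exists2 m, 0 < m & forall x, `[c, d]%classic x -> m <= f x.
Proof.
move=> cd cf f0; have [u uK hu] := EVT_min cd cf.
by exists (f u); [exact: f0|move=> x Kx; exact: hu].
Qed.

(** Heine's theorem. The near-covering form of compactness turns the local
    bounds, each valid on some neighbourhood and for all small radii, into one
    radius for the whole segment. *)
Lemma within_itv_unif_continuous (R : realType) (c d : R) (f : R -> R) (e : R) :
  0 < e -> {within `[c, d], continuous f} ->
  exists2 delta, 0 < delta &
    forall x y, `[c, d]%classic x -> `[c, d]%classic y -> `|x - y| <= delta ->
      `|f x - f y| <= e.
Proof.
set K := `[c, d]%classic => e0 /within_continuousP cf.
have /compact_near_coveringP/near_covering_withinP cov := @segment_compact R c d.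
have e20 : 0 < e / 2 by lra.
have : \forall r \near (0 : R)^'+, K `<=`
    [set x | forall y, K y -> `|x - y| <= r -> `|f x - f y| <= e].
  apply: (cov _ _ (fun r x => forall y, K y -> `|x - y| <= r -> `|f x - f y| <= e)).
  move=> x Kx; have [r r0 hr] := cf x _ Kx e20.
  have r20 : 0 < r / 2 by lra.
  exists (ball x (r / 2), [set s | s < r / 2]) => /=.
    split; first exact: nbhsx_ballx.
    exact: nbhs_right_lt.
  move=> [x' s] /= [xx' sr] Kx' y Ky x'y; rewrite /ball /= in xx'.
  have h1 : `|f x - f x'| <= e / 2 by apply: hr => //; lra.
  have h2 : `|f x - f y| <= e / 2.
    apply: hr => //.
    have -> : x - y = (x - x') + (x' - y) by ring.
    by rewrite (le_lt_trans (ler_normD _ _)) //; lra.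
  have -> : f x' - f y = - (f x - f x') + (f x - f y) by ring.
  by rewrite (le_trans (ler_normD _ _)) // normrN; lra.
move=> H; near (0 : R)^'+ => r.
exists r => // x y Kx Ky xy.
have H' : K `<=` [set x | forall y, K y -> `|x - y| <= r -> `|f x - f y| <= e]
  by near: r.
exact: H' xy.
Unshelve. all: by end_near. Qed.

Lemma unit_vector_angle (R : realType) (C S : R) : C ^+ 2 + S ^+ 2 = 1 ->
  exists eta, C = cos eta /\ S = sin eta.
Proof.
move=> CS; have C1 : -1 <= C <= 1.
  by apply/andP; split; nra.
have S2 : 1 - C ^+ 2 = S ^+ 2 by rewrite -CS addrC addKr.
have [S0|/ltW S0] := leP 0 S.
  exists (acos C); rewrite acosK ?in_itv//; split=> //.
  by rewrite sin_acos // S2 sqrtr_sqr ger0_norm.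
exists (- acos C); rewrite cosN sinN acosK ?in_itv//; split=> //.
by rewrite sin_acos // S2 sqrtr_sqr ler0_norm // opprK.
Qed.

(** As long as two unit vectors make an acute angle, the signed angle between them
    is the arcsine of their cross product, hence a continuous function of them.
    Both the choice of the phase increments and the lifting of the initial angle
    rest on this. *)
Lemma turn_by_asin (R : realType) (phi C S : R) : C ^+ 2 + S ^+ 2 = 1 ->
  0 < cos phi * C + sin phi * S ->
  C = cos (phi + asin (cos phi * S - sin phi * C)) /\
  S = sin (phi + asin (cos phi * S - sin phi * C)).
Proof.
move=> CS dot0; have cs := cos2Dsin2 phi.
set co := cos phi in dot0 cs *; set si := sin phi in dot0 cs *.
have LS : (co * S - si * C) ^+ 2 + (co * C + si * S) ^+ 2 = 1.
  transitivity ((co ^+ 2 + si ^+ 2) * (C ^+ 2 + S ^+ 2)); first by ring.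
  by rewrite cs CS mulr1.
have B : -1 <= co * S - si * C <= 1 by apply/andP; split; nra.
rewrite cosD sinD asinK ?in_itv // cos_asin //.
have -> : 1 - (co * S - si * C) ^+ 2 = (co * C + si * S) ^+ 2 by rewrite -LS; ring.
rewrite sqrtr_sqr gtr0_norm // -/co -/si; split.
  transitivity (C * (co ^+ 2 + si ^+ 2)); [by rewrite cs mulr1|ring].
transitivity (S * (co ^+ 2 + si ^+ 2)); [by rewrite cs mulr1|ring].
Qed.

Lemma minr_dist (R : realType) (x y t : R) :
  `|Num.min x t - Num.min y t| <= `|x - y|.
Proof.
have := ler_norm (x - y); have := ler_norm (- (x - y)); rewrite normrN.
by rewrite ler_norml !minElt; do 2 case: ltP => ?; move=> ? ?;
  apply/andP; split; lra.
Qed.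

Lemma within_continuous_minr (R : realType) (c d t : R) (f : R -> R) :
  c <= t -> {within `[c, d], continuous f} ->
  {within `[c, d], continuous (fun x => f (Num.min x t))}.
Proof.
set K := `[c, d]%classic => ct /within_continuousP cf.
have minK x : K x -> K (Num.min x t).
  rewrite /K /= !in_itv /= => /andP[cx xd].
  by rewrite le_min cx ct ge_min xd.
apply/within_continuousP => x e Kx e0.
have [r r0 hr] := cf _ _ (minK x Kx) e0; exists r => // y Ky xy.
apply: hr; first exact: minK.
exact: le_lt_trans (minr_dist _ _ _) xy.
Qed.

(** Path lifting for the circle. The segment is cut at points [t k] so close to
    each other that the unit vectors at [Num.min x (t k)] and
    [Num.min x (t k.+1)] always make an acute angle; the angle at
    [Num.min x (t k)] is then lifted by induction on [k], each step adding an
    arcsine. Truncating the argument at [t k], rather than restricting to a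
    subinterval, keeps every function defined and continuous on the whole
    segment, so that no gluing is needed. *)
Lemma angle_lift (R : realType) (c d : R) (C S : R -> R) : c <= d ->
  {within `[c, d], continuous C} -> {within `[c, d], continuous S} ->
  (forall x, `[c, d]%classic x -> C x ^+ 2 + S x ^+ 2 = 1) ->
  exists eta : R -> R, {within `[c, d], continuous eta} /\
    forall x, `[c, d]%classic x -> C x = cos (eta x) /\ S x = sin (eta x).
Proof.
set K := `[c, d]%classic => cd cC cS CS1.
have h0 : 0 < 2^-1 :> R by lra.
have [r1 r10 hC] := within_itv_unif_continuous h0 cC.
have [r2 r20 hS] := within_itv_unif_continuous h0 cS.
pose r := Num.min r1 r2; have r0 : 0 < r by rewrite lt_min r10.
pose t k : R := c + k%:R * r.
have ct k : c <= t k by rewrite lerDl mulr_ge0 // ltW.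
have tS k : t k.+1 = t k + r by rewrite /t -natr1; ring.
have minK x k : K x -> K (Num.min x (t k)).
  by rewrite /K /= !in_itv /= => /andP[cx xd]; rewrite le_min cx ct ge_min xd.
suff [eta [ceta heta]] : exists eta : R -> R, {within K, continuous eta} /\
    forall x, K x -> C (Num.min x (t (Num.truncn ((d - c) / r)).+1)) = cos (eta x) /\
      S (Num.min x (t (Num.truncn ((d - c) / r)).+1)) = sin (eta x).
  exists eta; split => // x Kx; have := heta x Kx.
  suff -> : Num.min x (t (Num.truncn ((d - c) / r)).+1) = x by [].
  apply/min_idPl; apply: (@le_trans _ _ d).
    by move: Kx; rewrite /K /= in_itv /= => /andP[].
  have := truncnS_gt ((d - c) / r).
  by rewrite ltr_pdivrMr // /t => h; lra.
elim: _.+1 => [|k [eta [ceta heta]]].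
  have [eta etaE] : exists eta, C c = cos eta /\ S c = sin eta.
    by apply: unit_vector_angle; apply: CS1; rewrite /K /= in_itv /= lexx.
  exists (fun _ => eta); split; first exact: within_continuous_cst.
  move=> x; rewrite /K /= in_itv /= => /andP[cx _].
  by rewrite /t mul0r addr0; have /min_idPr -> := cx.
have ck := within_continuous_minr (ct k).
have ck1 := within_continuous_minr (ct k.+1).
have step x : K x -> 0 < cos (eta x) * C (Num.min x (t k.+1)) +
    sin (eta x) * S (Num.min x (t k.+1)).
  move=> Kx; have [<- <-] := heta x Kx.
  have close : `|Num.min x (t k) - Num.min x (t k.+1)| <= r.
    have := minr_dist (t k) (t k.+1) x.
    rewrite tS opprD addNKr normrN (gtr0_norm r0).
    by rewrite (minC x (t k)) (minC x (t k + r)).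
  have := hC _ _ (minK x k Kx) (minK x k.+1 Kx) (le_trans close _).
  rewrite ge_min lexx => /(_ isT).
  have := hS _ _ (minK x k Kx) (minK x k.+1 Kx) (le_trans close _).
  rewrite ge_min lexx orbT => /(_ isT).
  have := CS1 _ (minK x k Kx); have := CS1 _ (minK x k.+1 Kx).
  (* 2 (v . w) = |v|^2 + |w|^2 - |v - w|^2, and here |v - w|^2 <= 1/2. *)
  by rewrite !ler_norml => ? ? /andP[? ?] /andP[? ?]; nra.
exists (fun x => eta x + asin (cos (eta x) * S (Num.min x (t k.+1)) -
    sin (eta x) * C (Num.min x (t k.+1)))); split; last first.
  by move=> x Kx; apply: turn_by_asin; [exact: CS1 (minK _ _ Kx)|exact: step].
apply: within_continuous_add => //.
apply: within_continuous_comp.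
  apply: within_continuous_add.
    apply: within_continuous_mul; last exact: ck1.
    by apply: within_continuous_comp => // x _; exact: continuous_cos.
  apply: within_continuous_opp; apply: within_continuous_mul; last exact: ck1.
  by apply: within_continuous_comp => // x _; exact: continuous_sin.
move=> x Kx; apply: continuous_asin.
have := step x Kx; have := CS1 _ (minK x k.+1 Kx); have := cos2Dsin2 (eta x).
set C' := C _; set S' := S _; set co := cos _; set si := sin _ => h1 h2 h3.
have LS : (co * S' - si * C') ^+ 2 + (co * C' + si * S') ^+ 2 = 1.
  transitivity ((co ^+ 2 + si ^+ 2) * (C' ^+ 2 + S' ^+ 2)); first by ring.
  by rewrite h1 h2 mulr1.
by apply/andP; split; nra.
Qed.

(** * Asymptotic rotations of the plane *)

Lemma near_infty_succ (P : nat -> Prop) :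
  (\forall n \near \oo, P n) -> \forall n \near \oo, P n.+1.
Proof. by move=> [N _ PN]; exists N => // n Nn; apply: PN; exact: leqW. Qed.

(** If the plane vector [(y n x, u n x)] has a length tending to [rho x] and each
    step is, up to [o(1)], the rotation by [theta x], then its polar angle can be
    followed exactly: the step turns it by [theta x] plus the small signed angle
    between the rotated vector and the next one. The functions [th j] are defined
    as these exact turns, and [eta] as a continuous polar angle of the [M]-th
    vector, so the phase in the conclusion carries no error; the error comes only
    from replacing the length by its limit. From the rank [M] on, the lengths stay
    away from 0 and the corrections are too small to push [th j] out of
    [(0, pi)]. *)
Lemma asymptotic_rotation (R : realType) (c d : R) (y u : nat -> R -> R)
    (theta rho : R -> R) (K := `[c, d]%classic) :
  c <= d ->
  (forall n, {within K, continuous (y n)}) ->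
  (forall n, {within K, continuous (u n)}) ->
  {within K, continuous theta} -> (forall x, K x -> 0 < theta x < pi) ->
  {within K, continuous rho} -> (forall x, K x -> 0 < rho x) ->
  unif0 K (fun n x => y n x ^+ 2 + u n x ^+ 2 - rho x ^+ 2) ->
  unif0 K (fun n x =>
    y n.+1 x - (y n x * cos (theta x) - u n x * sin (theta x))) ->
  unif0 K (fun n x =>
    u n.+1 x - (u n x * cos (theta x) + y n x * sin (theta x))) ->
  exists (M : nat) (eta : R -> R) (th : nat -> R -> R),
    [/\ (1 <= M)%N,
        {within K, continuous eta},
        forall j, {within K, continuous (th j)} /\
          (forall x, K x -> 0 < th j x < pi),
        unif0 K (fun n x => u n x
          - rho x * sin (\sum_(M.+1 <= j < n.+1) th j x + eta x))
      & unif0 K (fun j x => th j x - theta x)].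
Proof.
move=> cd cy cu ctheta theta_itv crho rho_gt0 lim_rho err_y err_u.
have [m m0 hm] := within_itv_gt0 cd crho rho_gt0.
have [d1 d10 hd1] : exists2 d1, 0 < d1 & forall x, K x -> d1 <= theta x.
  by apply: within_itv_gt0 => // x /theta_itv/andP[].
have [d2 d20 hd2] : exists2 d2, 0 < d2 & forall x, K x -> d2 <= pi - theta x.
  apply: within_itv_gt0 => //.
    apply: within_continuous_add; first exact: within_continuous_cst.
    exact: within_continuous_opp.
  by move=> x /theta_itv/andP[_]; rewrite subr_gt0.
pose ra n x := Num.sqrt (y n x ^+ 2 + u n x ^+ 2).
have ra_sqr n x : ra n x ^+ 2 = y n x ^+ 2 + u n x ^+ 2.
  by rewrite sqr_sqrtr // addr_ge0 // sqr_ge0.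
have ra_ge0 n x : 0 <= ra n x by exact: sqrtr_ge0.
have ra_ge : \forall n \near \oo, forall x, K x -> m / 2 <= ra n x.
  have m20 : 0 < m ^+ 2 / 2 by rewrite divr_gt0 // exprn_gt0.
  near=> n => x Kx.
  have : `|y n x ^+ 2 + u n x ^+ 2 - rho x ^+ 2| <= m ^+ 2 / 2.
    by move: x Kx; near: n; exact: lim_rho.
  have := hm x Kx; have := ra_ge0 n x; have := ra_sqr n x.
  by rewrite ler_norml => ? ? ? /andP[? ?]; nra.
pose C n x := y n x / ra n x; pose S n x := u n x / ra n x.
have unit n x : 0 < ra n x -> C n x ^+ 2 + S n x ^+ 2 = 1.
  move=> r0; rewrite /C /S !expr_div_n -mulrDl -ra_sqr divff //.
  by rewrite expf_neq0 // gt_eqF.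
(* [(C' n x, S' n x)] is the unit vector [(C n x, S n x)] rotated by [theta x]. *)
pose C' n x := C n x * cos (theta x) - S n x * sin (theta x).
pose S' n x := S n x * cos (theta x) + C n x * sin (theta x).
have unit' n x : 0 < ra n x -> C' n x ^+ 2 + S' n x ^+ 2 = 1.
  move=> r0; transitivity ((C n x ^+ 2 + S n x ^+ 2) *
      (cos (theta x) ^+ 2 + sin (theta x) ^+ 2)).
    by rewrite /C' /S'; ring.
  by rewrite unit // cos2Dsin2 mulr1.
pose ey n x := y n.+1 x - (y n x * cos (theta x) - u n x * sin (theta x)).
pose eu n x := u n.+1 x - (u n x * cos (theta x) + y n x * sin (theta x)).
have ey0 : unif0 K ey by []. have eu0 : unif0 K eu by [].
(* The sine and the cosine of the angle from the rotated vector to the next one. *)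
pose cross n x := C' n x * S n.+1 x - S' n x * C n.+1 x.
pose dot n x := C' n x * C n.+1 x + S' n x * S n.+1 x.
have crossE n x : 0 < ra n x -> 0 < ra n.+1 x ->
    cross n x = (C' n x * eu n x - S' n x * ey n x) / ra n.+1 x.
  move=> r0 r1; rewrite /cross /C' /S' /eu /ey /C /S; field.
  by rewrite !gt_eqF.
have dotE n x : 0 < ra n x -> 0 < ra n.+1 x ->
    dot n x = (ra n x + C' n x * ey n x + S' n x * eu n x) / ra n.+1 x.
  move=> r0 r1; rewrite -[X in (X + _ + _) / _](mulr1 (ra n x)) -(unit' n x r0).
  rewrite /dot /C' /S' /eu /ey /C /S; field.
  by rewrite !gt_eqF.
have cross_dot n x : 0 < ra n x -> 0 < ra n.+1 x ->
    cross n x ^+ 2 + dot n x ^+ 2 = 1.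
  move=> r0 r1; transitivity
    ((C' n x ^+ 2 + S' n x ^+ 2) * (C n.+1 x ^+ 2 + S n.+1 x ^+ 2)).
    by rewrite /cross /dot; ring.
  by rewrite unit' // unit // mulr1.
have m20 : 0 < m / 2 by lra. have m80 : 0 < m / 8 by lra.
have ra_gt : \forall n \near \oo, forall x, K x -> 0 < ra n x /\ 0 < ra n.+1 x.
  near=> n => x Kx; split.
    by apply: lt_le_trans m20 _; move: x Kx; near: n.
  apply: lt_le_trans m20 _; move: x Kx; near: n.
  exact: near_infty_succ ra_ge.
have cross0 : unif0 K cross.
  have le1 a b : a ^+ 2 + b ^+ 2 = 1 -> `|a| <= 1 /\ `|b| <= 1 :> R.
    by move=> ab; rewrite !ler_norml; split; apply/andP; split; nra.
  have CB : unif_bounded K C'.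
    exists 1; near=> n => x Kx.
    have [r0 _] : 0 < ra n x /\ 0 < ra n.+1 x by move: x Kx; near: n.
    by have [] := le1 _ _ (unit' n x r0).
  have SB : unif_bounded K S'.
    exists 1; near=> n => x Kx.
    have [r0 _] : 0 < ra n x /\ 0 < ra n.+1 x by move: x Kx; near: n.
    by have [] := le1 _ _ (unit' n x r0).
  have RB : unif_bounded K (fun n x => (ra n.+1 x)^-1).
    exists (m / 2)^-1; near=> n => x Kx.
    have r1 : m / 2 <= ra n.+1 x.
      move: x Kx; near: n.
      exact: near_infty_succ ra_ge.
    have r0 : 0 < ra n.+1 x by exact: lt_le_trans r1.
    by rewrite gtr0_norm ?invr_gt0 // lef_pV2.
  apply: (@unif0_le _ _ _ (fun n x =>
    (C' n x * eu n x - S' n x * ey n x) / ra n.+1 x)).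
    near=> n => x Kx.
    have [r0 r1] : 0 < ra n x /\ 0 < ra n.+1 x by move: x Kx; near: n.
    by rewrite crossE.
  by apply: unif0M => //; apply: unif0B; exact: unif0Ml.
have asin_0 : asin 0 = 0 :> R.
  rewrite -{1}(@sin0 R) sinK // in_itv /= oppr_le0 andbb.
  by rewrite divr_ge0 // pi_ge0.
have turn0 : unif0 K (fun n x => asin (cross n x)).
  by apply: unif0_comp => //; apply: continuous_asin; lra.
have [M0 _ good] : \forall n \near \oo, forall x, K x ->
   [/\ 0 < ra n x, 0 < dot n x, - d1 < asin (cross n x) & asin (cross n x) < d2].
  have d30 : 0 < Num.min d1 d2 / 2 by rewrite divr_gt0 // lt_min d10.
  near=> n => x Kx.
  have [r0 r1] : 0 < ra n x /\ 0 < ra n.+1 x by move: x Kx; near: n.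
  have rm : m / 2 <= ra n x by move: x Kx {r0 r1}; near: n.
  have : `|asin (cross n x)| <= Num.min d1 d2 / 2.
    by move: x Kx {rm r0 r1}; near: n; exact: turn0.
  have : `|ey n x| <= m / 8 by move: x Kx {rm r0 r1}; near: n; exact: ey0.
  have : `|eu n x| <= m / 8 by move: x Kx {rm r0 r1}; near: n; exact: eu0.
  have : Num.min d1 d2 <= d1 by rewrite ge_min lexx.
  have : Num.min d1 d2 <= d2 by rewrite ge_min lexx orbT.
  rewrite !ler_norml => ? ? /andP[? ?] /andP[? ?] /andP[? ?].
  split; [by []| |lra|lra].
  have CS1 := unit' n x r0.
  rewrite dotE // divr_gt0 //.
  have : - (m / 8) <= C' n x * ey n x by nra.
  have : - (m / 8) <= S' n x * eu n x by nra.
  by lra.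
Unshelve. all: try by end_near.
have good_ra n x : (M0 <= n)%N -> K x -> 0 < ra n x.
  by move=> Mn Kx; have [] := good n Mn x Kx.
have cra n : {within K, continuous (ra n)}.
  apply: within_continuous_comp; last by move=> x _; exact: sqrt_continuous.
  by apply: within_continuous_add; exact: within_continuous_mul.
have cC n : (M0 <= n)%N -> {within K, continuous (C n)}.
  move=> Mn; apply: within_continuous_mul => //; apply: within_continuous_inv => //.
  by move=> x Kx; rewrite gt_eqF // good_ra.
have cS n : (M0 <= n)%N -> {within K, continuous (S n)}.
  move=> Mn; apply: within_continuous_mul => //; apply: within_continuous_inv => //.
  by move=> x Kx; rewrite gt_eqF // good_ra.
have ccos : {within K, continuous (fun x => cos (theta x))}.
  by apply: within_continuous_comp => // x _; exact: continuous_cos.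
have csin : {within K, continuous (fun x => sin (theta x))}.
  by apply: within_continuous_comp => // x _; exact: continuous_sin.
have cturn n : (M0 <= n)%N -> {within K, continuous (fun x => asin (cross n x))}.
  move=> Mn; have Mn1 := leqW Mn; apply: within_continuous_comp; last first.
    move=> x Kx; apply: continuous_asin; have [_ dot_gt0 _ _] := good n Mn x Kx.
    have := cross_dot n x (good_ra n x Mn Kx) (good_ra n.+1 x Mn1 Kx).
    by move=> ?; apply/andP; split; nra.
  apply: within_continuous_add; last apply: within_continuous_opp.
    apply: within_continuous_mul; last exact: cS.
    apply: within_continuous_add; last apply: within_continuous_opp.
      by apply: within_continuous_mul => //; exact: cC.
    by apply: within_continuous_mul => //; exact: cS.
  apply: within_continuous_mul; last exact: cC.
  apply: within_continuous_add.
    by apply: within_continuous_mul => //; exact: cS.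
  by apply: within_continuous_mul => //; exact: cC.
pose M := M0.+1.
have [eta [ceta etaE]] : exists eta : R -> R, {within K, continuous eta} /\
    forall x, K x -> C M x = cos (eta x) /\ S M x = sin (eta x).
  apply: angle_lift => //; [exact: cC|exact: cS|].
  by move=> x Kx; apply: unit; exact: good_ra.
pose th j x := if (j <= M0)%N then theta x else theta x + asin (cross j.-1 x).
exists M, eta, th; split => //.
- case=> [|j].
    split; first exact: (within_continuous_eq _ ctheta).
    by move=> x /theta_itv.
  rewrite /th; have [jM|jM] := leqP j.+1 M0.
    by split => //; exact: (within_continuous_eq _ ctheta).
  split; first by apply: within_continuous_add => //; exact: cturn.
  move=> x Kx; have [_ _ ? ?] := good j jM x Kx.
  have := hd1 x Kx; have := hd2 x Kx => ? ?.
  by apply/andP; split; rewrite /=; lra.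
- have phase k x : K x ->
      C (M + k)%N x = cos (\sum_(M.+1 <= j < (M + k).+1) th j x + eta x) /\
      S (M + k)%N x = sin (\sum_(M.+1 <= j < (M + k).+1) th j x + eta x).
    move=> Kx; elim: k => [|k [IHC IHS]].
      by rewrite addn0 big_geq // add0r; exact: etaE.
    have Mk : (M0 <= M + k)%N by rewrite /M; lia.
    rewrite addnS big_nat_recr /=; last by rewrite ltnS leq_addr.
    rewrite {2 4}/th leqNgt ltnS Mk /=.
    have [_ dot_gt0 _ _] := good _ Mk x Kx.
    set phi := \sum_(_ <= j < _) _ + _ in IHC IHS.
    have -> : \sum_(M.+1 <= j < (M + k).+1) th j x +
        (theta x + asin (cross (M + k)%N x)) + eta x
       = (phi + theta x) + asin (cross (M + k)%N x) by rewrite /phi; ring.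
    have C'E : C' (M + k)%N x = cos (phi + theta x) by rewrite cosD -IHC -IHS.
    have S'E : S' (M + k)%N x = sin (phi + theta x) by rewrite sinD -IHC -IHS.
    rewrite /cross /dot C'E S'E in dot_gt0 *.
    by apply: turn_by_asin => //; apply: unit; apply: good_ra => //; exact: leqW.
  apply: (@unif0_le _ _ _ (fun n x =>
    (y n x ^+ 2 + u n x ^+ 2 - rho x ^+ 2) * m^-1)); last first.
    apply: unif0M => //; exists `|m^-1|; exact: nearW.
  near=> n => x Kx.
  have Mn : (M <= n)%N by near: n; exact: nbhs_infty_ge.
  have [_] := phase (n - M)%N x Kx; rewrite subnKC // => phaseE.
  have ra0 : 0 < ra n x by apply: good_ra => //; exact: ltnW.
  rewrite -ra_sqr; have -> : u n x = ra n x * S n x.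
    by rewrite /S mulrC divfK // gt_eqF.
  rewrite phaseE -mulrBl normrM.
  (* |ra - rho| <= |ra^2 - rho^2| / m, because ra + rho >= m. *)
  apply: (@le_trans _ _ `|ra n x - rho x|).
    by rewrite ler_piMr // ler_norml sin_geN1 sin_le1.
  rewrite normrM (gtr0_norm (x := m^-1)) ?invr_gt0 // ler_pdivlMr //.
  rewrite subr_sqr normrM ler_wpM2l //.
  have := hm x Kx => ?.
  by rewrite ger0_norm; lra.
- move=> e e0; have [N0 _ small] := turn0 e e0.
  exists (M0 + N0).+1 => // -[|j] // Mj x Kx.
  rewrite /th ifF; last by apply/negbTE; rewrite -ltnNge; rewrite /= in Mj; lia.
  by rewrite addrC addKr; apply: small => //; rewrite /= in Mj *; lia.
Unshelve. all: by end_near. Qed.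

(** * Transfer matrices *)

(** Pointwise convergence of polynomials of bounded degree is uniform on a segment:
    Lagrange interpolation at [m.+1] points expresses them, and the limit, as
    combinations of fixed polynomials with the values at these points as
    coefficients. The points exist only if [c < d]; a one-point segment is
    treated apart. *)
Lemma bounded_degree_unif0 (R : realType) (c d : R) (m : nat)
    (q : nat -> {poly R}) (l : R -> R) : c <= d ->
  (forall n, (size (q n) <= m.+1)%N) ->
  (forall x, `[c, d]%classic x -> (q n).[x] @[n --> \oo] --> l x) ->
  unif0 `[c, d]%classic (fun n x => (q n).[x] - l x).
Proof.
set K := `[c, d]%classic => cd qs ql.
have ql0 x : K x -> (q n).[x] - l x @[n --> \oo] --> 0.
  by move=> Kx; apply/subr_cvg0/ql.
have [cd1|] := ltP c d; last first.
  move=> dc; have cdE : d = c by apply/eqP; rewrite eq_le cd dc.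
  have Kc : K c by rewrite /K /= in_itv /= lexx.
  apply: unif0_eq (cvg_unif0 K (ql0 c Kc)) => n x.
  by rewrite /K /= in_itv /= cdE => /le_anti ->.
pose xs j := c + (d - c) / j.+1%:R.
have xsK j : K (xs j).
  rewrite /K /= in_itv /= lerDl divr_ge0 ?subr_ge0 //=.
  by rewrite -lerBrDl ler_pdivrMr // ler_peMr ?subr_ge0 // ler1n.
have xs_inj : injective xs.
  move=> j k /addrI; have dc0 : d - c != 0 by rewrite subr_eq0 gt_eqF.
  by move=> /(mulfI dc0)/invr_inj/eqP; rewrite eqr_nat => /eqP[].
pose L i := tnth (m.+1.-lagrange xs) i : {poly R}.
have qE n x : (q n).[x] = \sum_(i < m.+1) (q n).[xs i] * (L i).[x].
  rewrite {1}(lagrange_gen (ltn0Sn m) xs_inj (qs n)) horner_sum.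
  by apply: eq_bigr => i _; rewrite hornerM hornerC.
have lE x : K x -> l x = \sum_(i < m.+1) l (xs i) * (L i).[x].
  move=> Kx; apply: (cvg_unique _ (ql x Kx)); first exact: norm_hausdorff.
  rewrite [X in X @ _](_ : _ = (fun n => \sum_(i < m.+1) (q n).[xs i] * (L i).[x])).
    by apply: cvg_big => [|i _]; [exact: add_continuous|apply: cvgMl; exact: ql].
  by apply/funext => n; exact: qE.
apply: (@unif0_eq _ _ _ (fun n x =>
  \sum_(i < m.+1) ((q n).[xs i] - l (xs i)) * (L i).[x])).
  move=> n x Kx; rewrite qE lE // -sumrB; apply: eq_bigr => i _.
  by rewrite mulrBl.
apply: unif0_sum => i; apply: unif0M; first by apply: cvg_unif0; exact: ql0.
apply: within_itv_bounded => //; apply: continuous_subspaceT.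
exact: continuous_horner.
Qed.

Lemma mulmx2E (R : pzRingType) m p (A : 'M[R]_(m, 2)) (B : 'M[R]_(2, p)) i j :
  (A *m B) i j = A i 0 * B 0 j + A i 1 * B 1 j.
Proof.
rewrite mxE big_ord_recl big_ord1.
by congr (_ * _ + A i _ * B _ _); apply/val_inj.
Qed.

Lemma det_mx2 (R : comPzRingType) (A : 'M[R]_2) :
  \det A = A 0 0 * A 1 1 - A 0 1 * A 1 0.
Proof.
rewrite (expand_det_row A 0) big_ord_recl big_ord1 /cofactor !det_mx11 !mxE /=.
have l01 : lift 0 0 = 1 :> 'I_2 by exact/val_inj.
have l10 : lift 1 0 = 0 :> 'I_2 by exact/val_inj.
by rewrite !l01 l10 expr0 expr1 mul1r mulN1r mulrN.
Qed.

Lemma mxtrace2 (R : pzRingType) (A : 'M[R]_2) : \tr A = A 0 0 + A 1 1.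
Proof.
by rewrite /mxtrace big_ord_recl big_ord1; congr (_ + A _ _); apply/val_inj.
Qed.

Lemma discr2 (R : realType) (A : 'M[R]_2) :
  discr A = (A 0 0 - A 1 1) ^+ 2 + 4 * A 0 1 * A 1 0.
Proof. by rewrite /discr mxtrace2 det_mx2; ring. Qed.

Lemma nstep_mxS (R : realType) (a b : nat -> R) (N n : nat) (x : R) :
  nstep_mx a b N.+1 n x = nstep_mx a b N n.+1 x *m transfer_mx a b n x.
Proof.
by rewrite /nstep_mx /= rev_cons -cats1 big_cat big_seq1.
Qed.

Lemma transfer_mx_poly (R : realType) (a b : nat -> R) n (k l : 'I_2) :
  exists q : {poly R}, (size q <= 2)%N /\
    forall x, transfer_mx a b n x k l = q.[x].
Proof.
have sc (r : R) : (size (r%:P) <= 2)%N by rewrite (leq_trans (size_polyC_leq1 _)).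
case: k => [[|[|//]] hk]; case: l => [[|[|//]] hl].
- by exists 0%:P; split=> // x; rewrite mxE hornerC.
- by exists 1%:P; split=> // x; rewrite mxE hornerC.
- by exists (- (a n.-1 / a n))%:P; split=> // x; rewrite mxE hornerC.
- exists ((a n)^-1 *: ('X - (b n)%:P)); split.
    by rewrite (leq_trans (size_scale_leq _ _)) // size_XsubC.
  by move=> x; rewrite mxE hornerZ hornerXsubC /= mulrC.
Qed.

Lemma nstep_mx_poly (R : realType) (a b : nat -> R) N n (k l : 'I_2) :
  exists q : {poly R}, (size q <= N.+1)%N /\
    forall x, nstep_mx a b N n x k l = q.[x].
Proof.
elim: N n k l => [|N IH] n k l.
  exists ((k == l)%:R)%:P; split; first exact: size_polyC_leq1.
  by move=> x; rewrite /nstep_mx big_nil mxE hornerC.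
have [q0 [s0 h0]] := IH n.+1 k 0; have [q1 [s1 h1]] := IH n.+1 k 1.
have [t0 [u0 g0]] := transfer_mx_poly a b n 0 l.
have [t1 [u1 g1]] := transfer_mx_poly a b n 1 l.
exists (q0 * t0 + q1 * t1); split.
  have sm (q t : {poly R}) : (size q <= N.+1)%N -> (size t <= 2)%N ->
      (size (q * t)%R <= N.+2)%N.
    by have := size_polyMleq q t; lia.
  by rewrite (leq_trans (size_polyD _ _)) // geq_max !sm.
by move=> x; rewrite nstep_mxS mulmx2E hornerD !hornerM h0 h1 g0 g1.
Qed.

(** The determinant of each factor is a ratio of consecutive [a]'s, and the
    product telescopes. *)
Lemma det_nstep_mx (R : realType) (a b : nat -> R) N n (x : R) :
  (forall k, 0 < a k) -> (0 < n)%N ->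
  \det (nstep_mx a b N n x) = a n.-1 / a (n + N).-1.
Proof.
move=> a0; elim: N n => [|N IH] n n0.
  by rewrite /nstep_mx big_nil det1 addn0 divff // gt_eqF.
rewrite nstep_mxS det_mulmx IH // addSnnS (det_mx2 (transfer_mx _ _ _ _)) !mxE /=.
have : a n != 0 by rewrite gt_eqF.
have : a (n + N.+1).-1 != 0 by rewrite gt_eqF.
by move=> ? ?; field; apply/andP.
Qed.

Lemma nstep_mx_orthpoly (R : realType) (a b : nat -> R) N n (x : R) (k : 'I_2) :
  (forall k, 0 < a k) -> (0 < n)%N ->
  (orthpoly a b ((n + N).-1 + k)%N).[x] =
    nstep_mx a b N n x k 0 * (orthpoly a b n.-1).[x] +
    nstep_mx a b N n x k 1 * (orthpoly a b n).[x].
Proof.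
move=> a0; elim: N n => [|N IH] n n0.
  rewrite /nstep_mx big_nil !mxE addn0; case: k => [[|[|//]] hk] /=.
    by rewrite addn0 mul1r mul0r addr0.
  by rewrite addn1 prednK // mul1r mul0r add0r.
have an : a n != 0 by rewrite gt_eqF.
rewrite -addSnnS IH // nstep_mxS !mulmx2E !mxE /=.
have := orthpoly_rec b x a0 n0.
move=> rec; have -> : (orthpoly a b n.+1).[x] =
   (x - b n) / a n * (orthpoly a b n).[x] - a n.-1 / a n * (orthpoly a b n.-1).[x].
  apply: (mulfI an).
  transitivity ((x - b n) * (orthpoly a b n).[x] - a n.-1 * (orthpoly a b n.-1).[x]).
    by rewrite mulrBl -rec; ring.
  by field.
by ring.
Qed.

(** * Recurrences with an elliptic limit matrix *)

(** The quadratic form [u * v0 - s * v1] in [(s, u)], where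
    [(v0, v1) = A *m (s, u)]: it expresses the determinant that defines [g]
    through a single vector. Its discriminant is [discr A], so it is definite when
    [discr A < 0]. *)
Definition wronskian_form (R : pzRingType) (A : 'M[R]_2) (s u : R) : R :=
  A 0 1 * u ^+ 2 + (A 0 0 - A 1 1) * (u * s) - A 1 0 * s ^+ 2.

(** Completing the square: [A 0 1] times the form is a square minus
    [discr A / 4 * s ^+ 2], and symmetrically in [u]. *)
Lemma wronskian_form_ge (R : realType) (A : 'M[R]_2) (s u : R) :
  - discr A * s ^+ 2 <= 4 * `|A 0 1 * wronskian_form A s u| /\
  - discr A * u ^+ 2 <= 4 * `|A 1 0 * wronskian_form A s u|.
Proof.
rewrite discr2 /wronskian_form.
set A00 := A 0 0; set A01 := A 0 1; set A10 := A 1 0; set A11 := A 1 1.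
split.
  have := ler_norm (A01 * (A01 * u ^+ 2 + (A00 - A11) * (u * s) - A10 * s ^+ 2)).
  have := sqr_ge0 (A01 * u + (A00 - A11) / 2 * s).
  by set n := `|_|; nra.
have := ler_norm (- (A10 * (A01 * u ^+ 2 + (A00 - A11) * (u * s) - A10 * s ^+ 2))).
have := sqr_ge0 (A10 * s + (A11 - A00) / 2 * u).
by rewrite normrN; set n := `|_|; nra.
Qed.

(** The limit matrix [X x] has determinant 1 and complex eigenvalues, so it is
    conjugate to the rotation by [acos (\tr (X x) / 2)]. In suitable coordinates
    [(y, u)] the recurrence is therefore asymptotically this rotation, and
    [y ^+ 2 + u ^+ 2] is proportional to [wronskian_form (X x) s u], whose absolute
    value converges to [g x]; this is the setting of [asymptotic_rotation].
    The convergence of the form serves twice: being definite it bounds [s] and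
    [u], which makes all errors uniformly small, and it gives the amplitude. *)
Lemma elliptic_recurrence (R : realType) (c d : R) (A : nat -> R -> 'M[R]_2)
    (X : R -> 'M[R]_2) (sig : nat -> R) (s u : nat -> R -> R) (g : R -> R)
    (K := `[c, d]%classic) :
  c <= d ->
  (forall k l, {within K, continuous (fun x => X x k l)}) ->
  (forall k l, unif0 K (fun n x => A n x k l - X x k l)) ->
  (forall x, K x -> \det (X x) = 1) ->
  (forall x, K x -> discr (X x) < 0) ->
  sig n @[n --> \oo] --> (1 : R) ->
  (forall n, {within K, continuous (s n)}) ->
  (forall n, {within K, continuous (u n)}) ->
  (forall n x, (0 < n)%N ->
    s n.+1 x = sig n * (A n x 0 0 * s n x + A n x 0 1 * u n x)) ->
  (forall n x, (0 < n)%N ->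
    u n.+1 x = sig n * (A n x 1 0 * s n x + A n x 1 1 * u n x)) ->
  {within K, continuous g} -> (forall x, K x -> 0 < g x) ->
  unif0 K (fun n x => `|wronskian_form (A n x) (s n x) (u n x)| - g x) ->
  exists (M : nat) (eta : R -> R) (th : nat -> R -> R),
    [/\ (1 <= M)%N,
        {within K, continuous eta},
        forall j, {within K, continuous (th j)} /\
          (forall x, K x -> 0 < th j x < pi),
        unif0 K (fun n x => u n x
          - Num.sqrt (4 * `|X x 1 0| * g x / - discr (X x))
            * sin (\sum_(M.+1 <= j < n.+1) th j x + eta x))
      & unif0 K (fun j x => th j x - acos (\tr (X x) / 2))].
Proof.
move=> cd cX AX detX discrX sig1 cs cu recs recu cg g0 Qg.
have XB k l : unif_bounded K (fun _ x => X x k l) by exact: within_itv_bounded.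
have AB k l : unif_bounded K (fun n x => A n x k l).
  exact: unif_bounded_lim (AX k l) _.
have gB : unif_bounded K (fun _ => g) by exact: within_itv_bounded.
have QB := unif_bounded_lim Qg gB.
have cdiscr : {within K, continuous (fun x => discr (X x))}.
  apply: (within_continuous_eq (f := fun x =>
      (X x 0 0 - X x 1 1) * (X x 0 0 - X x 1 1) + 4 * X x 0 1 * X x 1 0)).
    by move=> x _; rewrite discr2 expr2.
  apply: within_continuous_add; last first.
    by do 2 apply: within_continuous_mul => //; exact: within_continuous_cst.
  by apply: within_continuous_mul; apply: within_continuous_add => //;
    exact: within_continuous_opp.
have discr_lim : unif0 K (fun n x => discr (A n x) - discr (X x)).
  have AX2 : unif0 K (fun n x => (A n x 0 0 - A n x 1 1) - (X x 0 0 - X x 1 1)).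
    by apply: unif0_eq (unif0B (AX 0 0) (AX 1 1)) => n x _; ring.
  have X2 : unif_bounded K (fun _ x => X x 0 0 - X x 1 1).
    by apply: unif_boundedD => //; exact: unif_boundedN.
  have A2 : unif_bounded K (fun n x => A n x 0 0 - A n x 1 1).
    by apply: unif_boundedD => //; exact: unif_boundedN.
  apply: unif0_eq (unif0D (unif0_limM X2 A2 AX2 AX2)
    (unif0Ml (unif_bounded_cst K 4)
      (unif0_limM (XB 0 1) (AB 1 0) (AX 0 1) (AX 1 0)))).
  by move=> n x _; rewrite !discr2; ring.
have [m m0 hm] : exists2 m, 0 < m & forall x, K x -> m <= - discr (X x).
  apply: within_itv_gt0 => //; first exact: within_continuous_opp.
  by move=> x Kx; rewrite oppr_gt0 discrX.
have discrA : \forall n \near \oo, forall x, K x -> m / 2 <= - discr (A n x).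
  have m20 : 0 < m / 2 by lra.
  near=> n => x Kx.
  have : `|discr (A n x) - discr (X x)| <= m / 2.
    by move: x Kx; near: n; exact: discr_lim.
  by have := hm x Kx; rewrite ler_norml => ? /andP[? ?]; lra.
(* Since [- discr (A n x)] is bounded below, a bound of the form bounds [s] and [u]. *)
have bound k l (f : nat -> R -> R) :
    (forall n x, - discr (A n x) * f n x ^+ 2 <=
      4 * `|A n x k l * wronskian_form (A n x) (s n x) (u n x)|) ->
    unif_bounded K f.
  move=> hf.
  have [B hB] := unif_boundedM (AB k l) QB.
  exists (8 / m * B + 1); near=> n => x Kx.
  have hd : m / 2 <= - discr (A n x) by move: x Kx; near: n.
  have wB : `|A n x k l * `|wronskian_form (A n x) (s n x) (u n x)| | <= B.
    by move: x Kx {hd}; near: n.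
  rewrite normrM normr_id -normrM in wB.
  have f2 : m / 2 * f n x ^+ 2 <= 4 * B.
    apply: (@le_trans _ _ (- discr (A n x) * f n x ^+ 2)).
      by rewrite ler_wpM2r // sqr_ge0.
    by apply: le_trans (hf n x) _; lra.
  have : f n x ^+ 2 <= 8 / m * B.
    have -> : 8 / m * B = 4 * B / (m / 2) by field; rewrite gt_eqF.
    by rewrite ler_pdivlMr ?divr_gt0 // mulrC.
  clear; move: (f n x) (8 / m * B) => v r; rewrite ler_norml => ?.
  by apply/andP; split; nra.
have uB : unif_bounded K u.
  by apply: (bound 1 0) => n x; have [] := wronskian_form_ge (A n x) (s n x) (u n x).
have sB : unif_bounded K s.
  by apply: (bound 0 1) => n x; have [] := wronskian_form_ge (A n x) (s n x) (u n x).
have sig0 : unif0 K (fun n _ => sig n - 1).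
  by apply: cvg_unif0; apply/subr_cvg0.
(* One step of the recurrence is one step of the limiting recurrence, up to a
   uniformly negligible error. *)
have step k (v : nat -> R -> R) :
    (forall n x, (0 < n)%N ->
      v n.+1 x = sig n * (A n x k 0 * s n x + A n x k 1 * u n x)) ->
    unif0 K (fun n x => v n.+1 x - (X x k 0 * s n x + X x k 1 * u n x)).
  move=> recv; apply: (@unif0_le _ _ _ (fun n x =>
     (sig n - 1) * (A n x k 0 * s n x + A n x k 1 * u n x) +
     ((A n x k 0 - X x k 0) * s n x + (A n x k 1 - X x k 1) * u n x))).
    near=> n => x Kx; rewrite recv; last by near: n; exact: nbhs_infty_gt.
    by rewrite le_eqVlt; apply/orP; left; apply/eqP; congr `|_|; ring.
  apply: unif0D; last by apply: unif0D; exact: unif0M.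
  by apply: unif0M => //; apply: unif_boundedD; exact: unif_boundedM.
have es := step 0 s recs; have eu := step 1 u recu.
pose theta x := acos (\tr (X x) / 2).
pose si x := Num.sqrt (- discr (X x)) / 2.
have si_gt0 x : K x -> 0 < si x.
  by move=> Kx; rewrite divr_gt0 // sqrtr_gt0 oppr_gt0 discrX.
have si_sqr x : K x -> si x ^+ 2 = - discr (X x) / 4.
  move=> Kx; rewrite /si expr_div_n sqr_sqrtr; last first.
    by rewrite oppr_ge0 ltW // discrX.
  by rewrite -natrX.
have tr_sqr x : K x -> (\tr (X x) / 2) ^+ 2 + si x ^+ 2 = 1.
  by move=> Kx; rewrite si_sqr // /discr detX //; field.
have tr_itv x : K x -> -1 < \tr (X x) / 2 < 1.
  move=> Kx; have := tr_sqr x Kx; have := si_gt0 x Kx => ? ?.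
  by apply/andP; split; nra.
have cos_theta x : K x -> cos (theta x) = \tr (X x) / 2.
  by move=> Kx; rewrite acosK // in_itv /= !ltW //; have /andP[] := tr_itv x Kx.
have sin_theta x : K x -> sin (theta x) = si x.
  move=> Kx; rewrite sin_acos; last by rewrite !ltW //; have /andP[] := tr_itv x Kx.
  have -> : 1 - (\tr (X x) / 2) ^+ 2 = si x ^+ 2 by have := tr_sqr x Kx; lra.
  by rewrite sqrtr_sqr ger0_norm // ltW // si_gt0.
(* The value of [y] is forced: rotation by [theta] has to send the second
   coordinate [u] to [X x 1 0 * s + X x 1 1 * u = u * cos theta + y * sin theta]. *)
pose y n x := (X x 1 0 * s n x + (X x 1 1 - X x 0 0) / 2 * u n x) / si x.
have csi : {within K, continuous si}.
  apply: within_continuous_mul; last exact: within_continuous_cst.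
  apply: within_continuous_comp; last by move=> x _; exact: sqrt_continuous.
  exact: within_continuous_opp.
have csiV : {within K, continuous (fun x => (si x)^-1)}.
  by apply: within_continuous_inv => // x Kx; rewrite gt_eqF // si_gt0.
have cX10 : {within K, continuous (fun x => `|X x 1 0|)}.
  by apply: within_continuous_comp => // x _; exact: norm_continuous.
have ctheta : {within K, continuous theta}.
  apply: within_continuous_comp; last first.
    by move=> x Kx; apply: continuous_acos; exact: tr_itv.
  apply: within_continuous_mul; last exact: within_continuous_cst.
  apply: (within_continuous_eq (f := fun x => X x 0 0 + X x 1 1)).
    by move=> x _; rewrite mxtrace2.
  exact: within_continuous_add.
have X10 x : K x -> 0 < `|X x 1 0|.
  move=> Kx; rewrite normr_gt0; apply: contraTneq (discrX x Kx) => X10.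
  by rewrite discr2 X10 mulr0 addr0 -leNgt sqr_ge0.
pose rho x := Num.sqrt (4 * `|X x 1 0| * g x / - discr (X x)).
have rho_sqr x : K x -> rho x ^+ 2 = `|X x 1 0| * g x * ((si x)^-1 * (si x)^-1).
  move=> Kx; have dX := discrX x Kx; rewrite sqr_sqrtr; last first.
    by rewrite divr_ge0 ?oppr_ge0 ?(ltW dX) // mulr_ge0 ?(ltW (g0 x Kx)) // mulr_ge0.
  rewrite -invfM -expr2 si_sqr //; field.
  by rewrite lt_eqF.
have rho_gt0 x : K x -> 0 < rho x.
  move=> Kx; rewrite sqrtr_gt0 divr_gt0 ?oppr_gt0 ?discrX //.
  by rewrite mulr_gt0 ?g0 // mulr_gt0 ?X10.
have [|||||||M [eta [th [M1 ceta hth lim_u lim_th]]]] :=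
  asymptotic_rotation (c := c) (d := d) (y := y) (u := u) (theta := theta)
    (rho := rho) cd _ cu ctheta.
- move=> n; apply: within_continuous_mul => //.
  apply: within_continuous_add; first exact: within_continuous_mul.
  apply: within_continuous_mul => //.
  apply: within_continuous_mul; last exact: within_continuous_cst.
  by apply: within_continuous_add => //; exact: within_continuous_opp.
- move=> x Kx; have /andP[t1 t2] := tr_itv x Kx.
  by rewrite acos_gt0 ?acos_ltpi ?t1 ?t2 ?ltW.
- apply: within_continuous_comp; last by move=> x _; exact: sqrt_continuous.
  apply: within_continuous_mul.
    do 2 apply: within_continuous_mul => //; exact: within_continuous_cst.
  apply: within_continuous_inv; first exact: within_continuous_opp.
  by move=> x Kx; rewrite oppr_eq0 lt_eqF // discrX.
- exact: rho_gt0.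
- have lim_QX : unif0 K (fun n x => `|wronskian_form (X x) (s n x) (u n x)| - g x).
    apply: (@unif0_eq _ _ _ (fun n x => (`|wronskian_form (X x) (s n x) (u n x)|
      - `|wronskian_form (A n x) (s n x) (u n x)|) +
       (`|wronskian_form (A n x) (s n x) (u n x)| - g x))).
      by move=> n x _; ring.
    apply: unif0D => //.
    apply: (@unif0_le _ _ _ (fun n x => (A n x 0 1 - X x 0 1) * (u n x * u n x) +
      ((A n x 0 0 - X x 0 0) - (A n x 1 1 - X x 1 1)) * (u n x * s n x) -
       (A n x 1 0 - X x 1 0) * (s n x * s n x))).
      near=> n => x _; rewrite (le_trans (ler_dist_dist _ _)) // distrC.
      rewrite le_eqVlt; apply/orP; left; apply/eqP; congr `|_|.
      by rewrite /wronskian_form; ring.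
    apply: unif0B; last by apply: unif0M => //; exact: unif_boundedM.
    apply: unif0D; first by apply: unif0M => //; exact: unif_boundedM.
    by apply: unif0M; [exact: unif0B|exact: unif_boundedM].
  apply: (@unif0_eq _ _ _ (fun n x => (`|X x 1 0| * ((si x)^-1 * (si x)^-1)) *
     (`|wronskian_form (X x) (s n x) (u n x)| - g x))).
    move=> n x Kx; rewrite rho_sqr // mulrBr; congr (_ - _); last by ring.
    rewrite mulrAC -normrM.
    have si0 : si x != 0 by rewrite gt_eqF // si_gt0.
    have e : - (X x 1 0 * wronskian_form (X x) (s n x) (u n x)) =
      (X x 1 0 * s n x + (X x 1 1 - X x 0 0) / 2 * u n x) ^+ 2 +
        si x ^+ 2 * u n x ^+ 2.
      by rewrite si_sqr // discr2 /wronskian_form; field.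
    rewrite -normrN e ger0_norm; last first.
      by rewrite addr_ge0 ?sqr_ge0 // mulr_ge0 ?sqr_ge0.
    by rewrite /y; field.
  apply: unif0Ml => //; apply: within_itv_bounded => //.
  by do 2 apply: within_continuous_mul => //.
- apply: (@unif0_eq _ _ _ (fun n x => (X x 1 0 * (si x)^-1) *
     (s n.+1 x - (X x 0 0 * s n x + X x 0 1 * u n x)) +
     ((X x 1 1 - X x 0 0) / 2 * (si x)^-1) *
     (u n.+1 x - (X x 1 0 * s n x + X x 1 1 * u n x)))).
    move=> n x Kx; rewrite cos_theta // sin_theta //.
    have si0 : si x != 0 by rewrite gt_eqF // si_gt0.
    (* The square of [si x] is [- discr (X x) / 4], a polynomial in the entries. *)
    have e : u n x * si x = u n x * (- discr (X x) / 4) / si x.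
      by rewrite -si_sqr //; field.
    by rewrite e /y mxtrace2 discr2; field.
  apply: unif0D; apply: unif0Ml => //; apply: within_itv_bounded => //.
    exact: within_continuous_mul.
  apply: within_continuous_mul => //.
  apply: within_continuous_mul; last exact: within_continuous_cst.
  by apply: within_continuous_add => //; exact: within_continuous_opp.
- apply: unif0_eq eu => n x Kx; rewrite cos_theta // sin_theta // /y mxtrace2.
  by field; rewrite gt_eqF // si_gt0.
by exists M, eta, th.
Unshelve. all: by end_near. Qed.

(** * Asymptotics of the orthogonal polynomials *)

Lemma cvg_entry (R : realType) (A : nat -> 'M[R]_2) (X : 'M[R]_2) (k l : 'I_2) :
  A n @[n --> \oo] --> X -> A n k l @[n --> \oo] --> X k l.
Proof. move=> AX; exact: (cvg_comp _ _ AX (@coord_continuous _ _ _ k l X)). Qed.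

Lemma cvg_det2 (R : realType) (A : nat -> 'M[R]_2) (X : 'M[R]_2) :
  A n @[n --> \oo] --> X -> \det (A n) @[n --> \oo] --> \det X.
Proof.
move=> AX; rewrite det_mx2; under eq_fun do rewrite det_mx2.
by apply: cvgB; apply: cvgM; exact: cvg_entry.
Qed.

Lemma cvg_discr (R : realType) (A : nat -> 'M[R]_2) (X : 'M[R]_2) :
  A n @[n --> \oo] --> X -> discr (A n) @[n --> \oo] --> discr X.
Proof.
move=> AX; rewrite discr2; under eq_fun do rewrite discr2.
apply: cvgD; last first.
  by apply: cvgM; [apply: cvgM; [exact: cvg_cst|]|]; exact: cvg_entry.
rewrite expr2; under eq_fun do rewrite expr2.
by apply: cvgM; apply: cvgB; exact: cvg_entry.
Qed.

Theorem theoremC (R : realType) (a b : nat -> R) (N r i : nat) (c d : R)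
    (X : R -> 'M[R]_2) (h g dnu : R -> R) (nu : probability (measurableTypeR R) R)
    (K := `[c, d]%classic : set R)
    (p := orthpoly a b : nat -> {poly R})
    (a_gt0 : forall n, 0 < a n)
    (N_gt0 : (0 < N)%N) (r_gt0 : (0 < r)%N) (i_ltN : (i < N)%N)
    (cd : c <= d)
    (K_Lambda : K `<=` Lambda a b N i)
    (a_ratio : a ((n.+1 * N + i).-1) / a ((n * N + i).-1) @[n --> \oo]
       --> (1 : R))
    (X_classD : classD r K (fun n => nstep_mx a b N (n * N + i)))
    (X_unit : forall x, K x -> X x \in unitmx)
    (X_lim : forall x, K x -> nstep_mx a b N (n * N + i) x @[n --> \oo] --> X x)
    (h_lim : forall x, K x ->
       discr (nstep_mx a b N (n * N + i) x) @[n --> \oo] --> h x)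
    (g_gt0 : forall x, K x -> 0 < g x)
    (g_lim : supnorm K (fun x => a (n + N).-1 *
          `|(p n).[x] * (p (n + N).-1).[x] - (p n.-1).[x] * (p (n + N)%N).[x]|
          - g x)
       @[n --> within [set n | n = i %[mod N]] \oo] --> 0%E)
    (nu_orth : orthonormal_in nu p)
    (nu_density : has_density_on nu K dnu)
    (dnuE : forall x, K x -> dnu x = Num.sqrt (- h x) / (2 * pi * g x)) :
  exists (M : nat) (eta : R -> R) (theta : nat -> R -> R),
    [/\ (1 <= M)%N,
        {within K, continuous eta},
        forall j, {within K, continuous (theta j)} /\
          (forall x, K x -> 0 < theta j x < pi),
        supnorm K (fun x => Num.sqrt (a (n * N + i).-1) * (p (n * N + i)%N).[x]
          - Num.sqrt (2 * `|X x 1 0| / (pi * dnu x * Num.sqrt (- h x)))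
            * sin (\sum_(M.+1 <= j < n.+1) theta j x + eta x))
          @[n --> \oo] --> 0%E
      & supnorm K (fun x => theta j x - acos (\tr (X x) / 2))
          @[j --> \oo] --> 0%E].
Proof.
have K0 : K !=set0 by exists c; rewrite /K /= in_itv /= lexx.
pose m n := (n * N + i)%N.
pose A n x := nstep_mx a b N (m n) x.
have mS n : m n.+1 = (m n + N)%N by rewrite /m mulSn; lia.
have m_gt0 n : (0 < n)%N -> (0 < m n)%N.
  by move=> n0; rewrite /m addn_gt0 muln_gt0 n0 N_gt0.
have a0 k : a k != 0 by rewrite gt_eqF.
have discrE x : K x -> discr (X x) = h x.
  move=> Kx; apply: (cvg_unique _ (cvg_discr (X_lim x Kx)) (h_lim x Kx)).
  exact: norm_hausdorff.
have h_lt0 x : K x -> h x < 0.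
  move=> Kx; have [l hl l0] := K_Lambda x Kx.
  by rewrite (cvg_unique _ (h_lim x Kx) hl) //; exact: norm_hausdorff.
pose ratio n := a (m n.+1).-1 / a (m n).-1.
have ratio_gt0 n : 0 < ratio n by rewrite divr_gt0.
have ratioV : (ratio n)^-1 @[n --> \oo] --> (1 : R).
  by rewrite -[X in _ --> X]invr1; apply: cvgV => //; exact: oner_neq0.
have detX x : K x -> \det (X x) = 1.
  move=> Kx; apply: (cvg_unique _ (cvg_det2 (X_lim x Kx))).
    exact: norm_hausdorff.
  apply: cvg_trans ratioV; apply: near_eq_cvg; near=> n.
  rewrite det_nstep_mx //; last by apply: m_gt0; near: n; exact: nbhs_infty_gt.
  by rewrite /ratio mS invf_div.
have AX k l : unif0 K (fun n x => A n x k l - X x k l).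
  have [q qE] := choice (fun n => nstep_mx_poly a b N (m n) k l).
  apply: (@unif0_eq _ _ _ (fun n x => (q n).[x] - X x k l)).
    by move=> n x _; rewrite -(qE n).2.
  apply: (bounded_degree_unif0 (m := N)) => //; first by move=> n; exact: (qE n).1.
  move=> x Kx; rewrite [X in X @ _](_ : _ = fun n => A n x k l).
    exact: cvg_entry (X_lim x Kx).
  by apply/funext => n; rewrite -(qE n).2.
have cA n k l : {within K, continuous (fun x => A n x k l)}.
  have [q [_ qE]] := nstep_mx_poly a b N (m n) k l.
  apply: (within_continuous_eq (f := horner q)) => [x _|]; first by rewrite -qE.
  by apply: continuous_subspaceT; exact: continuous_horner.
have cX k l : {within K, continuous (fun x => X x k l)}.
  by apply: unif0_continuous (AX k l); exact: nearW.
have cp k : {within K, continuous (fun x => (p k).[x])}.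
  by apply: continuous_subspaceT; exact: continuous_horner.
pose s n x := Num.sqrt (a (m n).-1) * (p (m n).-1).[x].
pose u n x := Num.sqrt (a (m n).-1) * (p (m n)).[x].
(* The factor by which the normalisation of [s] and [u] changes in one step. *)
pose sig n := Num.sqrt (ratio n).
have sigE n : Num.sqrt (a (m n.+1).-1) = sig n * Num.sqrt (a (m n).-1).
  by rewrite /sig /ratio -sqrtrM ?divfK // ltW // divr_gt0.
have rec (k : 'I_2) n x : (0 < n)%N -> (p ((m n.+1).-1 + k)%N).[x] =
    A n x k 0 * (p (m n).-1).[x] + A n x k 1 * (p (m n)).[x].
  by move=> n0; rewrite mS nstep_mx_orthpoly // m_gt0.
have recs n x : (0 < n)%N -> (p (m n.+1).-1).[x] =
    A n x 0 0 * (p (m n).-1).[x] + A n x 0 1 * (p (m n)).[x].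
  by move=> n0; rewrite -(rec 0 n x n0) /= addn0.
have recu n x : (0 < n)%N -> (p (m n.+1)).[x] =
    A n x 1 0 * (p (m n).-1).[x] + A n x 1 1 * (p (m n)).[x].
  by move=> n0; rewrite -(rec 1 n x n0) /= addn1 prednK // m_gt0.
pose W n x := a (m n + N).-1 * `|(p (m n)).[x] * (p (m n + N).-1).[x]
  - (p (m n).-1).[x] * (p (m n + N)%N).[x]|.
have Wg : unif0 K (fun n x => W n x - g x).
  move=> e e0.
  have [n0 _ hn0] := (supnorm_cvg0P _ _ K0).1 g_lim e e0.
  exists n0 => // n /= n0n x Kx; apply: hn0 => //=.
    by rewrite /m (leq_trans n0n) //; nia.
  by rewrite /m modnMDl.
have cg : {within K, continuous g}.
  apply: unif0_continuous Wg; apply: nearW => n.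
  apply: within_continuous_mul; first exact: within_continuous_cst.
  apply: (within_continuous_comp (phi := fun z => `|z|)) => [|x _]; last first.
    exact: norm_continuous.
  by apply: within_continuous_add; [|apply: within_continuous_opp];
    exact: within_continuous_mul.
have Qg : unif0 K (fun n x => `|wronskian_form (A n x) (s n x) (u n x)| - g x).
  have rV0 : unif0 K (fun n _ => (ratio n)^-1 - 1).
    by apply: cvg_unif0; exact/subr_cvg0.
  have gB : unif_bounded K (fun _ => g) by exact: within_itv_bounded.
  have rVB : unif_bounded K (fun n _ => (ratio n)^-1).
    by apply: (unif_bounded_lim rV0); exact: unif_bounded_cst.
  apply: (@unif0_le _ _ _ (fun n x =>
    (ratio n)^-1 * (W n x - g x) + ((ratio n)^-1 - 1) * g x)).
    near=> n => x _; rewrite le_eqVlt; apply/orP; left; apply/eqP; congr `|_|.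
    have n0 : (0 < n)%N by near: n; exact: nbhs_infty_gt.
    have -> : wronskian_form (A n x) (s n x) (u n x) = a (m n).-1 *
        ((p (m n)).[x] * (p (m n.+1).-1).[x] - (p (m n).-1).[x] * (p (m n.+1)).[x]).
      rewrite -[X in X * _]sqr_sqrtr ?(ltW (a_gt0 _)) // recs // recu //.
      by rewrite /wronskian_form /s /u; ring.
    rewrite normrM (gtr0_norm (a_gt0 _)) /W -mS /ratio.
    by field; rewrite !a0.
  by apply: unif0D; [exact: unif0Ml|exact: unif0M].
have [||||||M [eta [th [M1 ceta hth lim_u lim_th]]]] :=
  elliptic_recurrence (sig := sig) (s := s) (u := u) cd cX AX detX
    _ _ _ _ _ _ cg g_gt0 Qg.
- by move=> x Kx; rewrite discrE // h_lt0.
- rewrite -[X in _ --> X](@sqrtr1 R).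
  exact: (cvg_comp _ _ a_ratio (@sqrt_continuous _ _)).
- move=> n; apply: within_continuous_mul => //; exact: within_continuous_cst.
- move=> n; apply: within_continuous_mul => //; exact: within_continuous_cst.
- by move=> n x n0; rewrite /s /u sigE recs //; ring.
- by move=> n x n0; rewrite /s /u sigE recu //; ring.
exists M, eta, th; split => //; apply: unif0_supnorm => //.
have ampl x : K x -> Num.sqrt (2 * `|X x 1 0| / (pi * dnu x * Num.sqrt (- h x))) =
    Num.sqrt (4 * `|X x 1 0| * g x / - discr (X x)).
  move=> Kx; congr Num.sqrt; rewrite dnuE // discrE //.
  have hh : Num.sqrt (- h x) ^+ 2 = - h x.
    by rewrite sqr_sqrtr // oppr_ge0 ltW // h_lt0.
  have sh : Num.sqrt (- h x) != 0 by rewrite gt_eqF // sqrtr_gt0 oppr_gt0 h_lt0.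
  have pi0 : pi != 0 :> R by rewrite gt_eqF // pi_gt0.
  have gx0 : g x != 0 by rewrite gt_eqF // g_gt0.
  move: hh sh pi0; move: (Num.sqrt _) (pi : R) => w q <- w0 q0.
  by field; rewrite q0 w0 gx0.
by apply: unif0_eq lim_u => n x Kx; rewrite ampl.
Unshelve. all: by end_near. Qed.
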